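(* Let $k$ be a constant and suppose each amoebot of a connected amoebot structure holds an input value in $\{1,\dots,k\}$. In the geometric amoebot model with reconfigurable circuits, the consensus problem, in which all amoebots have to agree on one of the input values held by the amoebots, can be solved within $O(1)$ rounds.
   Context: Amoebot model with circuits. $G_{eqt}=(V,E)$ is the infinite regular triangular grid graph. A set of $n$ amoebots occupies a finite set $S\subseteq V$ of nodes, $|S|=n$, exactly one amoebot per node of $S$; the induced graph $G_S=G_{eqt}|_S$ is connected; amoebots do not move. Amoebots on adjacent nodes are neighbors and are joined by a bond. All amoebots are anonymous and run the same randomized finite state machine (constant memory, independent of $n$). Each amoebot assigns locally unique labels to its incident edges; amoebots need not agree on a compass orientation nor on a chirality. Every edge incident to an amoebot carries the same constant number of pins (for this theorem any number $\ge 1$) in a fixed linear order; the pins on a bond are shared by the two neighbors. Each amoebot chooses a pin configuration: an arbitrary set of undirected wires between pins on its own incident edges. If $P$ is the set of all pins and $C$ the set of all wires, a circuit is a connected component of the graph $(P,C)$; an amoebot is part of a circuit iff the circuit contains a pin on one of its bonds. Time proceeds in synchronous rounds; in each round every amoebot reads its memory and the beeps received on its circuits, computes and updates its memory, and then may reconfigure its wires and send a beep on any of its circuits. A beep sent on a circuit is received in the next round by all amoebots of that circuit; an amoebot only learns whether at least one beep was sent on the circuit, not the origin nor the number of senders. Running time is the number of rounds. The constant $k$ is known to (encoded in the state machine of) all amoebots. Asymptotics are in $n$. *)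

(* Defs.v *)
From mathcomp Require Import all_boot all_order all_algebra all_fingroup.
From mathcomp Require Import finmap.

Set Implicit Arguments.
Unset Strict Implicit.
Unset Printing Implicit Defensive.

Local Open Scope fset_scope.

(** The infinite triangular grid, in axial coordinates: [(x, y)] stands for the
    point [x + y * exp (i pi / 3)], so the six directions below are the sixth
    roots of unity in counterclockwise order. *)

Notation node := (int * int)%type.

Definition directions : 6.-tuple node :=
  [tuple (1, 0); (0, 1); (-1, 1); (-1, 0); (0, -1); (1, -1)]%R.

Definition neighbor (u : node) (d : 'I_6) : node :=
  (u + tnth directions d)%R.

Definition adjacent : rel node :=
  fun u v => [exists d : 'I_6, v == neighbor u d].

Definition connected_structure (S : {fset node}) : Prop :=
  S != fset0 /\
  forall u v : S, connect (fun x y : S => adjacent (val x) (val y)) u v.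

(** A labeling attaches to every amoebot a bijection from the labels ['I_6] to
    the grid directions, i.e. to its incident edges; no relation between the
    bijections of different amoebots is required. *)

Definition labeling (S : {fset node}) : Type := S -> {perm 'I_6}.

(** An amoebot names its own pins by an edge label and by the rank of the pin in
    the linear order of the pins on that edge. *)

Definition lpin (c : nat) : finType := ('I_6 * 'I_c)%type.

(** A wire is undirected: [(p, q)] and [(q, p)] have the same meaning. *)

Definition pin_config (c : nat) : Type := {set lpin c * lpin c}.

(** [action] is what an amoebot leaves behind at the end of a round: its memory,
    its wires, and pins naming the circuits on which it beeps. *)

Record action (state : Type) (c : nat) := Action {
  memory : state;
  wires : pin_config c;
  beeps : {set lpin c}
}.

(** In each round the machine reads its memory, the set of its pins whose
    circuit carried a beep, and [nbits] fair independent random bits. An output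
    of [None] means undecided. *)

Record machine (k c : nat) := Machine {
  state : finType;
  nbits : nat;
  init : 'I_k -> state;
  step : state -> {set lpin c} -> nbits.-tuple bool -> action state c;
  output : state -> option 'I_k
}.

Section Circuits.

Variables (c : nat) (S : {fset node}) (lab : labeling S).

Definition far_end (u : S) (l : 'I_6) : node := neighbor (val u) (lab u l).

Definition bond (u : S) (l : 'I_6) : bool := far_end u l \in S.

(** A pin lies on an edge, which is an unordered pair of nodes; hence the two
    ends of a bond share its pins. The edges towards unoccupied nodes also carry
    pins, but only the pins on bonds make an amoebot part of a circuit. *)

Definition gpin (u : S) (p : lpin c) : {fset node} * 'I_c :=
  ([fset val u; far_end u p.1], p.2).

Definition pins : {fset {fset node} * 'I_c} :=
  [fset gpin x.1 x.2 | x in [set: S * lpin c]].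

Lemma gpin_in_pins (u : S) (p : lpin c) : gpin u p \in pins.
Proof. by apply/imfsetP; exists (u, p); rewrite //= inE. Qed.

Definition pin_at (u : S) (p : lpin c) : pins := [` gpin_in_pins u p].

Variables (state : Type) (cf : S -> action state c).

Definition wired : rel pins := fun x y =>
  [exists u : S, exists p : lpin c, exists q : lpin c,
    [&& ((p, q) \in wires (cf u)) || ((q, p) \in wires (cf u)),
        x == pin_at u p & y == pin_at u q]].

Definition circuit (x : pins) : {set pins} := [set y | connect wired x y].

Definition part_of (u : S) (K : {set pins}) : bool :=
  [exists p : lpin c, bond u p.1 && (pin_at u p \in K)].

Definition beep_sent (K : {set pins}) : bool :=
  [exists u : S, part_of u K && [exists p in beeps (cf u), pin_at u p \in K]].

Definition received (u : S) : {set lpin c} :=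
  [set p | part_of u (circuit (pin_at u p)) & beep_sent (circuit (pin_at u p))].

End Circuits.

Section Execution.

Variables (k c : nat) (M : machine k c) (S : {fset node}) (lab : labeling S).
Variables (inp : S -> 'I_k) (coins : nat -> S -> (nbits M).-tuple bool).

(** The situation after [t] rounds. *)

Fixpoint run (t : nat) : S -> action (state M) c :=
  if t is t'.+1 then
    fun u => step (memory (run t' u)) (received lab (run t') u) (coins t' u)
  else fun u => Action (init M (inp u)) set0 set0.

(** Every amoebot decides within [T] rounds, irrevocably, and all decide on the
    same value, which is the input of some amoebot. *)

Definition consensus_within (T : nat) : Prop :=
  exists v : 'I_k,
    (exists u : S, inp u = v) /\
    forall u : S, exists2 t0 : nat, t0 <= T &
      forall t : nat,
        output (memory (run t u)) = if t < t0 then None else Some v.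

End Execution.

(* Main.v *)
(** All amoebots wire all their pins together, so that the connected structure
    forms one circuit, and in successive rounds the holders of the values
    [0, 1, 2, ...] beep. The first value that is announced is the minimum of the
    inputs, and everyone decides on it on hearing the beep. *)

Require Import Defs.
From mathcomp Require Import all_boot all_algebra finmap.
From mathcomp Require Import fingroup perm.

Set Implicit Arguments.
Unset Strict Implicit.
Unset Printing Implicit Defensive.

Local Open Scope fset_scope.

Lemma adjacent_sym : symmetric adjacent.
Proof.
suff adj_imp u v : adjacent u v -> adjacent v u.
  by move=> u v; apply/idP/idP; apply: adj_imp.
(* The opposite direction lies three sixth-turns further along [directions]. *)
case/existsP=> d /eqP ->; apply/existsP; exists (inord ((d + 3) %% 6)).
rewrite /neighbor -GRing.addrA -GRing.subr_eq0 GRing.opprD GRing.addNKr.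
rewrite GRing.oppr_eq0 /tnth !inordK ?ltn_pmod //.
by case: d => [[|[|[|[|[|[|d]]]]]] ltd].
Qed.

Lemma connect_neq_edge (T : finType) (e : rel T) (x y : T) :
  connect e x y -> x != y -> exists z, e x z.
Proof.
case/connectP=> [[|z p]] /=; first by move=> _ ->; rewrite eqxx.
by case/andP=> xz _ _ _; exists z.
Qed.

Section FullWiring.

Variables (c : nat) (S : {fset node}) (lab : labeling S).

Lemma adjacent_far_end (u v : S) :
  adjacent (val u) (val v) -> exists l, far_end lab u l = val v.
Proof.
case/existsP=> d /eqP ->; exists ((lab u)^-1%g d).
by rewrite /far_end permKV.
Qed.

Lemma adjacent_bond (u v : S) :
  adjacent (val u) (val v) -> exists l, bond lab u l.
Proof.
by case/adjacent_far_end=> l e; exists l; rewrite /bond e (valP v).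
Qed.

Lemma adjacent_shared_pin (u v : S) (i : 'I_c) :
  adjacent (val u) (val v) ->
  exists p q : lpin c, pin_at lab u p = pin_at lab v q.
Proof.
move=> uv; have [l el] := adjacent_far_end uv.
have [l' el'] : exists l, far_end lab v l = val u.
  by apply: adjacent_far_end; rewrite adjacent_sym.
exists (l, i), (l', i); apply: val_inj; rewrite /= /gpin /=.
by rewrite el el' fsetUC.
Qed.

Variables (state : Type) (cf : S -> action state c).
Hypotheses (hc : 0 < c) (full : forall u, wires (cf u) = setT).
Hypothesis connS : connected_structure S.

(** A path of amoebots lifts to pins: inside each amoebot one wire leads to any of its pins, in
    particular to one shared with the next amoebot. *)
Lemma full_wiring_connect (u v : S) (p q : lpin c) :
  connect (wired cf) (pin_at lab u p) (pin_at lab v q).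
Proof.
have wu w r s : connect (wired cf) (pin_at lab w r) (pin_at lab w s).
  apply/connect1/existsP; exists w; apply/existsP; exists r.
  by apply/existsP; exists s; rewrite full !inE !eqxx.
case: connS => _ /(_ u v) /connectP[s].
elim: s u p => [|w s IHs] u p /= => [_ -> //|/andP[uw ws] ev].
have [r [r' er]] := adjacent_shared_pin (Ordinal hc) uw.
by apply: connect_trans (wu u p r) _; rewrite er; apply: IHs.
Qed.

(** With [u != w], connectivity gives both amoebots a bond, as [part_of] demands of receiver and
    sender alike. *)
Lemma full_wiring_received (u w : S) :
  u != w -> beeps (cf w) = setT -> received lab cf u != set0.
Proof.
move=> uw bw; have [_ conn] := connS.
have [x /adjacent_bond[l bl]] := connect_neq_edge (conn u w) uw.
have wu : w != u by rewrite eq_sym.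
have [y /adjacent_bond[m bm]] := connect_neq_edge (conn w u) wu.
apply/set0Pn; exists (l, Ordinal hc); rewrite inE; apply/andP; split.
  by apply/existsP; exists (l, Ordinal hc); rewrite bl inE connect0.
apply/existsP; exists w; apply/andP; split; apply/existsP;
  exists (m, Ordinal hc).
  by rewrite bm inE full_wiring_connect.
by rewrite bw !inE full_wiring_connect.
Qed.

End FullWiring.

Lemma received_beeps (c : nat) (S : {fset node}) (lab : labeling S)
    (state : Type) (cf : S -> action state c) (u : S) :
  received lab cf u != set0 -> exists w, beeps (cf w) != set0.
Proof.
case/set0Pn=> p; rewrite inE => /andP[_ /existsP[w /andP[_ /existsP[q]]]].
by case/andP=> bq _; exists w; apply/set0Pn; exists q.
Qed.

Section Algorithm.

Variables (k c : nat).

(** [inl (i, x)] is an undecided amoebot with input [x] after [i] rounds, and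
    [inr v] one that has decided on [v]. The value [v] is announced in round
    [v.+1], i.e. when the counter is [lift ord0 v]. *)

Definition min_state : finType := ('I_k.+1 * 'I_k + 'I_k)%type.

(** An amoebot counts its own beep as heard even when it is on no circuit, which
    is what makes a lone amoebot decide. *)

Definition min_step (s : min_state) (R : {set lpin c}) (_ : 0.-tuple bool) :
    action min_state c :=
  match s with
  | inr v => Action (inr v) set0 set0
  | inl (i, x) =>
    let wait := Action (inl (inord i.+1, x)) setT
                       (if x == i :> nat then setT else set0) in
    if unlift ord0 i is Some v then
      if (R != set0) || (x == v) then Action (inr v) set0 set0 else wait
    else wait
  end.

Definition min_machine : machine k c :=
  @Machine k c min_state 0 (fun x => inl (ord0, x)) min_step
    (fun s => if s is inr v then Some v else None).

Variables (S : {fset node}) (lab : labeling S) (inp : S -> 'I_k).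
Variable coins : nat -> S -> (nbits min_machine).-tuple bool.
Hypotheses (hc : 0 < c) (connS : connected_structure S).
Variable u0 : S.
Hypothesis min_u0 : forall u, inp u0 <= inp u.

Local Notation run := (run lab inp coins).

Lemma runS (t : nat) (u : S) :
  run t.+1 u =
  min_step (memory (run t u)) (received lab (run t) u) (coins t u).
Proof. by []. Qed.

(** Nobody beeps before the minimum is announced, so nobody decides. The case [t = inp u0] is that
    announcement, from which [run_decided] starts. *)
Lemma run_undecided (t : nat) (u : S) : t <= inp u0 ->
  run t.+1 u = Action (inl (inord t.+1, inp u)) setT
                      (if inp u == t :> nat then setT else set0).
Proof.
elim: t u => [|t IHt] u lt_t; first by rewrite /= unlift_none.
(* Keeps the counter [t.+1] within ['I_k.+1], so that [inord] does not return its default. *)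
have lt_k : t < k by apply: leq_trans lt_t (ltnW (ltn_ord _)).
have eu : unlift ord0 (inord t.+1 : 'I_k.+1) = Some (Ordinal lt_k).
  rewrite -[RHS](liftK ord0); congr unlift.
  by apply: val_inj; rewrite /= inordK.
rewrite runS; have -> : received lab (run t.+1) u = set0.
  apply/eqP/negPn/negP => /received_beeps[w].
  by rewrite IHt ?(ltnW lt_t) //= gtn_eqF ?eqxx // (leq_trans lt_t (min_u0 w)).
rewrite (IHt u) ?(ltnW lt_t) //= eu eqxx inordK //=.
by rewrite ifN // -val_eqE /= gtn_eqF // (leq_trans lt_t (min_u0 u)).
Qed.

Lemma run_decided (t : nat) (u : S) : inp u0 < t ->
  memory (run t.+1 u) = inr (inp u0).
Proof.
elim: t => // t IHt; rewrite ltnS leq_eqVlt => /orP[/eqP <-|/IHt]; last first.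
  by move=> IH; rewrite runS IH.
have eu : unlift ord0 (inord (inp u0).+1 : 'I_k.+1) = Some (inp u0).
  rewrite -[RHS](liftK ord0); congr unlift.
  by apply: val_inj; rewrite /= inordK ?ltnS.
have full w : wires (run (inp u0).+1 w) = setT by rewrite run_undecided.
rewrite runS run_undecided //= eu.
suff -> : (received lab (run (inp u0).+1) u != set0) || (inp u == inp u0) by [].
(* [u0] recognizes its own input, even when alone; every other amoebot hears its beep. *)
have [->|neq_u] := eqVneq u u0; first by rewrite eqxx orbT.
have beep_u0 : beeps (run (inp u0).+1 u0) = setT.
  by rewrite run_undecided //= eqxx.
by rewrite (full_wiring_received lab hc full connS neq_u beep_u0).
Qed.

End Algorithm.

(** The input values are the [k] elements of ['I_k], shifted down by one from
    [1, ..., k]. The running time [T] depends only on [k] and on the number [c]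
    of pins per edge, and the guarantee holds for every outcome [coins] of the
    random bits. *)

Theorem theorem3p1 (k c : nat) (hc : 0 < c) :
  exists (M : machine k c) (T : nat),
    forall (S : {fset node}) (lab : labeling S) (inp : S -> 'I_k)
           (coins : nat -> S -> (nbits M).-tuple bool),
      connected_structure S ->
      consensus_within lab inp coins T.
Proof.
exists (min_machine k c), k.+1 => S lab inp coins connS.
have [/fset0Pn[x xS] _] := connS.
case: (@arg_minnP S [` xS] xpredT inp) => // u0 _ /(_ _ isT) min_u0.
exists (inp u0); split; first by exists u0.
(* The minimum is beeped in round [(inp u0).+1] and heard one round later; [inp u0 < k] gives the
   bound [k.+1]. *)
move=> u; exists (inp u0).+2 => [|[|t]] //; first by rewrite ltnS.
rewrite ltnS; case: ltnP => t_u0.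
  by rewrite (run_undecided _ _ min_u0).
by rewrite (run_decided _ _ hc connS min_u0).
Qed.
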